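(* Let $S$ be a semiring that is positive, refinable and satisfies properties (B) and (E). Then the family $\delta=(\delta_X)_X$ defined for all sets $X$ and $\Phi\in\mathcal S\mathcal PX$ by \[ \delta_X(\Phi)=\Bigl\{\phi\in\mathcal SX\ \Bigm|\ \exists\psi\in\mathcal S(\ni_X).\ \forall A\in\mathcal PX.\ \Phi(A)=\sum_{x\in A}\psi(A,x),\ \ \forall x\in X.\ \phi(x)=\sum_{A\ni x}\psi(A,x)\Bigr\} \] is a weak distributive law $\delta\colon\mathcal S\mathcal P\to\mathcal P\mathcal S$ (namely the canonical one, arising from the unique extension of the functor $\mathcal S$ and of $\mu^{\mathcal S}$ to locally monotone structure on the category of sets and relations).
   Context: Properties of a semiring $S$: positive: $a+b=0\Rightarrow a=b=0$; refinable: $a+b=c+d$ implies there are $x,y,z,t$ with $x+y=a$, $z+t=b$, $x+z=c$, $y+t=d$; (B): $a\cdot b=0\Rightarrow a=0$ or $b=0$; (E): if $a+b=c\cdot d$ then there is $t\colon\{(x,y)\in S^2\mid x+y=d\}\to S$ with $\sum_{x+y=d}t(x,y)x=a$, $\sum_{x+y=d}t(x,y)y=b$, $\sum_{x+y=d}t(x,y)=c$. $\mathcal S$ is the monad on Set with $\mathcal SX$ the finitely supported $\phi\colon X\to S$, $\mathcal S(f)(\phi)(y)=\sum_{x\in f^{-1}\{y\}}\phi(x)$, unit $x\mapsto\Delta_x$, multiplication $\mu^{\mathcal S}_X(\Psi)(x)=\sum_{\phi\in\mathrm{supp}\Psi}\Psi(\phi)\phi(x)$. $\mathcal P$ is the powerset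 monad (unit singleton, multiplication union). $\ni_X=\{(A,x)\in\mathcal PX\times X\mid x\in A\}$. A weak distributive law of $\mathcal P$ over $\mathcal S$ is a natural transformation $\delta\colon\mathcal S\mathcal P\to\mathcal P\mathcal S$ with $\delta\circ\mathcal S\mu^{\mathcal P}=\mu^{\mathcal P}\mathcal S\circ\mathcal P\delta\circ\delta\mathcal P$, $\delta\circ\mu^{\mathcal S}\mathcal P=\mathcal P\mu^{\mathcal S}\circ\delta\mathcal S\circ\mathcal S\delta$, and $\delta\circ\mathcal S\eta^{\mathcal P}=\eta^{\mathcal P}\mathcal S$. *)

(* Defs.v *)
From HB Require Import structures.
From mathcomp Require Import all_boot all_algebra.
From mathcomp Require Import all_classical.

Set Implicit Arguments.
Unset Strict Implicit.
Unset Printing Implicit Defensive.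
Import GRing.Theory.
Local Open Scope classical_set_scope.
Local Open Scope ring_scope.

(* Semirings are [pzSemiRingType]s: multiplication is not assumed commutative
   and 0 = 1 is allowed.  Index sets are arbitrary types; [{classic I}] only
   supplies the choice structure that the finitely supported sums require. *)

Definition fsum (S : pzSemiRingType) (I : Type) (A : set I) (f : I -> S) : S :=
  \sum_(i \in (A : set {classic I})) f i.

Definition supp (S : pzSemiRingType) (X : Type) (f : X -> S) : set X :=
  [set x | f x <> 0].

Record fsfunc (S : pzSemiRingType) (X : Type) : Type := FSFunc {
  fsfunc_fun :> X -> S;
  fsfunc_fin : finite_set (supp fsfunc_fun) }.

Lemma fsum_neq0 (S : pzSemiRingType) (I : Type) (A : set I) (f : I -> S) :
  fsum A f <> 0 -> exists2 i, A i & f i <> 0.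
Proof.
move=> nz; apply: contrapT => H; apply: nz.
rewrite /fsum; apply: fsbig1 => i Ai.
by apply: contrapT => fi; apply: H; exists i.
Qed.

Section SemiringMonad.
Variable S : pzSemiRingType.

Lemma Smap_fin (X Y : Type) (f : X -> Y) (phi : fsfunc S X) :
  finite_set (supp (fun y => fsum (f @^-1` [set y]) phi)).
Proof.
apply: (sub_finite_set _ (finite_image f (fsfunc_fin phi))) => y /=.
by move=> /fsum_neq0 [x /= <- nz]; exists x.
Qed.

Definition Smap (X Y : Type) (f : X -> Y) (phi : fsfunc S X) : fsfunc S Y :=
  FSFunc (Smap_fin f phi).

Lemma Sunit_fin (X : Type) (x : X) :
  finite_set (supp (fun y => if `[< y = x >] then 1 : S else 0)).
Proof.
apply: (sub_finite_set _ (finite_set1 x)) => y /=.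
by rewrite /supp /=; case: asboolP.
Qed.

Definition Sunit (X : Type) (x : X) : fsfunc S X := FSFunc (Sunit_fin x).

Lemma Smult_fin (X : Type) (Psi : fsfunc S (fsfunc S X)) :
  finite_set (supp (fun x =>
    fsum (supp Psi) (fun phi : fsfunc S X => Psi phi * phi x))).
Proof.
apply: (@sub_finite_set _ _
  (\bigcup_(phi in supp Psi) supp (phi : fsfunc S X))); last first.
  by apply: bigcup_finite => [|phi _]; exact: fsfunc_fin.
move=> x /fsum_neq0 [phi Psiphi nz]; exists phi => // phi0.
by apply: nz; rewrite phi0 mulr0.
Qed.

Definition Smult (X : Type) (Psi : fsfunc S (fsfunc S X)) : fsfunc S X :=
  FSFunc (Smult_fin Psi).

End SemiringMonad.

Definition Pmap (X Y : Type) (f : X -> Y) (A : set X) : set Y := f @` A.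

Definition Punit (X : Type) (x : X) : set X := [set x].

Definition Pmult (X : Type) (AA : set (set X)) : set X :=
  \bigcup_(A in AA) A.

Definition positive_semiring (S : pzSemiRingType) : Prop :=
  forall a b : S, a + b = 0 -> a = 0 /\ b = 0.

Definition refinable_semiring (S : pzSemiRingType) : Prop :=
  forall a b c d : S, a + b = c + d ->
  exists x y z t : S, [/\ x + y = a, z + t = b, x + z = c & y + t = d].

Definition semiring_propB (S : pzSemiRingType) : Prop :=
  forall a b : S, a * b = 0 -> a = 0 \/ b = 0.

(* The weights t(x, y) are required to be finitely supported, so that the sums
   over the possibly infinite set of pairs with x + y = d are meaningful. *)
Definition semiring_propE (S : pzSemiRingType) : Prop :=
  forall a b c d : S, a + b = c * d ->
  exists t : fsfunc S {p : S * S | p.1 + p.2 = d},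
    [/\ fsum setT (fun p => t p * (sval p).1) = a,
        fsum setT (fun p => t p * (sval p).2) = b
      & fsum setT t = c].

Definition is_natural (S : pzSemiRingType)
    (d : forall X : Type, fsfunc S (set X) -> set (fsfunc S X)) : Prop :=
  forall (X Y : Type) (f : X -> Y),
    d Y \o Smap (Pmap f) = Pmap (Smap f) \o d X.

(* Compatibility with [Sunit] is not required: this is what makes the law
   weak. *)
Definition is_weak_distributive_law (S : pzSemiRingType)
    (d : forall X : Type, fsfunc S (set X) -> set (fsfunc S X)) : Prop :=
  [/\ is_natural d,
      (forall X : Type,
         d X \o Smap (@Pmult X) =
         @Pmult (fsfunc S X) \o Pmap (d X) \o d (set X)),
      (forall X : Type,
         d X \o @Smult S (set X) =
         Pmap (@Smult S X) \o d (fsfunc S X) \o Smap (d X))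
    & (forall X : Type,
         d X \o Smap (@Punit X) = @Punit (fsfunc S X))].

Definition ni (X : Type) : set (set X * X) := [set p | p.1 p.2].

Definition ni_pair (X : Type) (A : set X) (x : X) (Ax : A x) :
  {p : set X * X | ni p} := exist (@ni X) (A, x) Ax.

Definition delta (S : pzSemiRingType) (X : Type) (Phi : fsfunc S (set X)) :
    set (fsfunc S X) :=
  [set phi : fsfunc S X | exists psi : fsfunc S {p : set X * X | ni p},
     (forall A : set X,
        Phi A = fsum setT
          (fun x : {x : X | A x} => psi (@ni_pair X A (sval x) (svalP x)))) /\
     (forall x : X,
        phi x = fsum setT
          (fun A : {A : set X | A x} =>
             psi (@ni_pair X (sval A) x (svalP A))))].

(* A relation from X to Y is a [set (X * Y)], locally ordered by inclusion. *)

Definition rel_graph (X Y : Type) (f : X -> Y) : set (X * Y) :=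
  [set p | f p.1 = p.2].

Definition rel_comp (X Y Z : Type) (R : set (X * Y)) (Q : set (Y * Z)) :
  set (X * Z) := [set p | exists2 y, R (p.1, y) & Q (y, p.2)].

Definition is_monotone_extension (S : pzSemiRingType)
    (E : forall X Y : Type, set (X * Y) -> set (fsfunc S X * fsfunc S Y)) :
    Prop :=
  [/\ (forall X : Type, E X X diagonal = diagonal),
      (forall (X Y Z : Type) (R : set (X * Y)) (Q : set (Y * Z)),
         E X Z (rel_comp R Q) = rel_comp (E X Y R) (E Y Z Q)),
      (forall (X Y : Type) (R Q : set (X * Y)),
         R `<=` Q -> E X Y R `<=` E X Y Q)
    & (forall (X Y : Type) (f : X -> Y),
         E X Y (rel_graph f) = rel_graph (Smap f))].

(* The graphs of the components of the multiplication form a natural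
   transformation from E E to E on the category of relations. *)
Definition Smult_extends (S : pzSemiRingType)
    (E : forall X Y : Type, set (X * Y) -> set (fsfunc S X * fsfunc S Y)) :
    Prop :=
  forall (X Y : Type) (R : set (X * Y)),
    rel_comp (E _ _ (E X Y R)) (rel_graph (@Smult S Y)) =
    rel_comp (rel_graph (@Smult S X)) (E X Y R).

(* Under the correspondence between functions A -> set B and relations from A
   to B, the law arising from an extension E has as components the transposes
   of the relations E (ni X), from [fsfunc S (set X)] to [fsfunc S X]. *)
Definition is_canonical_law (S : pzSemiRingType)
    (d : forall X : Type, fsfunc S (set X) -> set (fsfunc S X)) : Prop :=
  exists E : forall X Y : Type, set (X * Y) -> set (fsfunc S X * fsfunc S Y),
    [/\ is_monotone_extension E,
        (forall E', is_monotone_extension E' ->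
           forall (X Y : Type) (R : set (X * Y)), E' X Y R = E X Y R),
        Smult_extends E
      & (forall (X : Type) (Phi : fsfunc S (set X)),
           d X Phi = [set phi | E _ _ (@ni X) (Phi, phi)])].

(* Main.v *)
(* A relation [R] acts on finitely supported functions through couplings
   supported in [R], so [Phi] and [phi] are related by [ni] exactly when
   [delta Phi phi].  Refinability and positivity make the functor preserve weak
   pullbacks, hence composition of relations; (B) and (E) make the naturality
   squares of the multiplication weak pullbacks, hence extend it to relations.
   Uniqueness holds because a monotone functor preserves the adjunction between
   a graph and its converse, and every relation is a converse graph followed by
   a graph.  The axioms of the law are then images of identities between
   relations. *)

Require Import Defs.
From HB Require Import structures.
From mathcomp Require Import all_boot all_algebra.
From mathcomp Require Import all_classical.

Set Implicit Arguments.
Unset Strict Implicit.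
Unset Printing Implicit Defensive.
Import GRing.Theory.
Local Open Scope classical_set_scope.
Local Open Scope ring_scope.

(** * Finitely supported functions as a commutative monoid *)

Lemma fsfuncP (S : pzSemiRingType) (X : Type) (f g : fsfunc S X) :
  (forall x, f x = g x) -> f = g.
Proof.
case: f g => f ff [g gf] /= /funext fg; subst g.
by congr FSFunc; exact: Prop_irrelevance.
Qed.

Section Module.
Variables (S : pzSemiRingType) (X : Type).

Lemma fszero_fin : finite_set (supp (fun _ : X => 0 : S)).
Proof. by apply: (sub_finite_set _ (finite_set0 X)) => x /=; apply. Qed.

Lemma fsadd_fin (f g : fsfunc S X) : finite_set (supp (fun x => f x + g x)).
Proof.
apply: (@sub_finite_set _ _ (supp f `|` supp g)); last first.
  by rewrite finite_setU; split; exact: fsfunc_fin.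
move=> x nz; apply: contrapT => /not_orP[/contrapT fx /contrapT gx].
by apply: nz; rewrite fx gx addr0.
Qed.

Lemma fssingle_fin (s : S) (x : X) :
  finite_set (supp (fun y => if `[< y = x >] then s else 0)).
Proof.
apply: (sub_finite_set _ (finite_set1 x)) => y /=.
by rewrite /supp /=; case: asboolP.
Qed.

Definition fszero : fsfunc S X := FSFunc fszero_fin.
Definition fsadd (f g : fsfunc S X) : fsfunc S X := FSFunc (fsadd_fin f g).
Definition fssingle (s : S) (x : X) : fsfunc S X := FSFunc (fssingle_fin s x).

HB.instance Definition _ := gen_eqMixin (fsfunc S X).
HB.instance Definition _ := gen_choiceMixin (fsfunc S X).

Lemma fsaddA : associative fsadd.
Proof. by move=> f g h; apply: fsfuncP => x /=; rewrite addrA. Qed.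
Lemma fsaddC : commutative fsadd.
Proof. by move=> f g; apply: fsfuncP => x /=; rewrite addrC. Qed.
Lemma fsadd0 : left_id fszero fsadd.
Proof. by move=> f; apply: fsfuncP => x /=; rewrite add0r. Qed.

HB.instance Definition _ :=
  GRing.isNmodule.Build (fsfunc S X) fsaddA fsaddC fsadd0.

Lemma fsfunD (f g : fsfunc S X) x : (f + g) x = f x + g x.
Proof. by []. Qed.

Lemma fsfun0 x : (0 : fsfunc S X) x = 0.
Proof. by []. Qed.

Lemma fssingleE s (x y : X) :
  fssingle s x y = if `[< y = x >] then s else 0.
Proof. by []. Qed.

Lemma fssingle0 (x : X) : fssingle 0 x = 0.
Proof. by apply: fsfuncP => y /=; case: ifP. Qed.

Lemma fssingleD s t (x : X) : fssingle (s + t) x = fssingle s x + fssingle t x.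
Proof. by apply: fsfuncP => y /=; case: ifP => //; rewrite addr0. Qed.

Lemma fsfunc_split (f : fsfunc S X) (x : X) :
  exists g : fsfunc S X,
    [/\ f = g + fssingle (f x) x, g x = 0 & supp g `<=` supp f].
Proof.
have gfin : finite_set (supp (fun y => if `[< y = x >] then 0 else f y)).
  apply: (sub_finite_set _ (fsfunc_fin f)) => y /=.
  by rewrite /supp /=; case: asboolP.
exists (FSFunc gfin); split.
- apply: fsfuncP => y /=; case: asboolP => [->|_]; first by rewrite add0r.
  by rewrite addr0.
- by rewrite /=; case: asboolP.
- by move=> y; rewrite /supp /=; case: asboolP.
Qed.

(** Induction on a list that only has to contain the support, removing the value at the head each
    time. The point added in the inductive step may already lie in the support. *)
Lemma fsfunc_ind (P : fsfunc S X -> Prop) :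
  P 0 -> (forall f s x, P f -> P (f + fssingle s x)) -> forall f, P f.
Proof.
move=> P0 PD f.
have [r] := (finite_seqP (supp f : set {classic X})).1 (fsfunc_fin f).
move=> sf; have {sf} : supp f `<=` [set` r] by rewrite sf.
elim: r f => [|x r IH] f sf.
  rewrite (_ : f = 0)//; apply: fsfuncP => x.
  by apply: contrapT => /sf.
have [g [Ef gx sg]] := fsfunc_split f x; rewrite Ef; apply/PD/IH => y gy.
have := sf y (sg y gy); rewrite /= inE => /orP[/eqP yx|//].
by case: gy; rewrite yx.
Qed.

End Module.

(** * Integrals against finitely supported functions; the functor and the multiplication *)

Section Integral.
Variables (S : pzSemiRingType).

(** [f] acts as a measure and [u] as an arbitrary integrand. The weights stand on the left, since
    multiplication need not commute. *)
Definition fsint (X : Type) (f : fsfunc S X) (u : X -> S) : S :=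
  fsum setT (fun x => f x * u x).

Lemma fsintE (X : Type) (f : fsfunc S X) (u : X -> S) (r : seq {classic X}) :
  uniq r -> supp f `<=` [set` r] -> fsint f u = \sum_(x <- r) f x * u x.
Proof.
move=> ur sr; rewrite /fsint /fsum (fsbigE r)//; last first.
  move=> x _ xr; have -> : f x = 0 by apply: contra_notP (negP xr) => /sr.
  by rewrite mul0r.
by apply: eq_bigl => x; rewrite in_setT.
Qed.

Lemma fsintDl (X : Type) (f g : fsfunc S X) u :
  fsint (f + g) u = fsint f u + fsint g u.
Proof.
have /finite_seqP[r E] : finite_set ((supp f `|` supp g) : set {classic X}).
  by rewrite finite_setU; split; exact: fsfunc_fin.
have sr : supp f `|` supp g `<=` [set` undup r].
  by move=> x fgx /=; rewrite mem_undup; have : [set` r] x by rewrite -E.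
rewrite !(@fsintE _ _ u (undup r)) ?undup_uniq//.
- by rewrite -big_split; apply: eq_bigr => x _; rewrite fsfunD mulrDl.
- by move=> x gx; apply: sr; right.
- by move=> x fx; apply: sr; left.
- move=> x nz; apply: sr.
  apply: contrapT => /not_orP[/contrapT fx /contrapT gx].
  by apply: nz; rewrite fsfunD fx gx addr0.
Qed.

Lemma fsint0l (X : Type) (u : X -> S) : fsint 0 u = 0.
Proof. by apply: fsbig1 => x _; rewrite mul0r. Qed.

Lemma fsint_single (X : Type) s (x : X) u : fsint (fssingle s x) u = s * u x.
Proof.
rewrite (@fsintE _ _ u [:: x]) ?big_seq1 /=; first by case: asboolP.
  by [].
by move=> y /=; rewrite /supp /= inE; case: asboolP => // ->; rewrite eqxx.
Qed.

Lemma eq_fsint (X : Type) (f : fsfunc S X) u v :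
  (forall x, supp f x -> u x = v x) -> fsint f u = fsint f v.
Proof.
move=> uv; apply: eq_fsbigr => x _.
by have [->|/uv->//] := pselect (f x = 0); rewrite !mul0r.
Qed.

Lemma fsintDr (X : Type) (f : fsfunc S X) u v :
  fsint f (fun x => u x + v x) = fsint f u + fsint f v.
Proof.
elim/fsfunc_ind: f => [|f s x IH]; first by rewrite !fsint0l addr0.
by rewrite !fsintDl IH !fsint_single mulrDr addrACA.
Qed.

Lemma fsint0r (X : Type) (f : fsfunc S X) : fsint f (fun=> 0) = 0.
Proof. by apply: fsbig1 => x _; rewrite mulr0. Qed.

Lemma fsintZr (X : Type) (f : fsfunc S X) u s :
  fsint f u * s = fsint f (fun x => u x * s).
Proof.
elim/fsfunc_ind: f => [|f t x IH]; first by rewrite !fsint0l mul0r.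
by rewrite !fsintDl mulrDl IH !fsint_single mulrA.
Qed.

Lemma fsint_cst (X : Type) (f : fsfunc S X) s :
  fsint f (fun=> s) = fsint f (fun=> 1) * s.
Proof. by rewrite fsintZr; apply: eq_fsint => x _; rewrite mul1r. Qed.

Lemma fsum_fsint (X : Type) (A : set X) (f : fsfunc S X) :
  fsum A f = fsint f (fun x => if `[< A x >] then 1 else 0).
Proof.
rewrite /fsint /fsum [LHS]fsbig_mkcond; apply: eq_fsbigr => x _.
rewrite /= /patch; case: ifPn => [/set_mem Ax|xA].
  by rewrite asboolT// mulr1.
by rewrite asboolF ?mulr0// => Ax; case/negP: xA; exact: mem_set.
Qed.

Lemma SmapE (X Y : Type) (p : X -> Y) (f : fsfunc S X) y :
  Smap p f y = fsint f (fun x => fssingle 1 (p x) y).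
Proof.
rewrite /= fsum_fsint; apply: eq_fsint => x _ /=.
by rewrite (asbool_equiv_eq (Q := y = p x)).
Qed.

Lemma SmapD (X Y : Type) (p : X -> Y) : {morph @Smap S X Y p : f g / f + g}.
Proof. by move=> f g; apply: fsfuncP => y; rewrite fsfunD !SmapE fsintDl. Qed.

Lemma Smap0 (X Y : Type) (p : X -> Y) : @Smap S X Y p 0 = 0.
Proof. by apply: fsfuncP => y; rewrite SmapE fsint0l. Qed.

Lemma Smap_single (X Y : Type) (p : X -> Y) (s : S) x :
  Smap p (fssingle s x) = fssingle s (p x) :> fsfunc S Y.
Proof.
apply: fsfuncP => y; rewrite SmapE fsint_single !fssingleE.
by case: ifP => _; rewrite ?mulr1 ?mulr0.
Qed.

Lemma fsint_Smap (X Y : Type) (p : X -> Y) f u :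
  fsint (Smap p f) u = fsint f (u \o p).
Proof.
elim/fsfunc_ind: f => [|f s x IH]; first by rewrite Smap0 !fsint0l.
by rewrite SmapD !fsintDl IH Smap_single !fsint_single.
Qed.

Lemma Smap_comp (X Y Z : Type) (p : X -> Y) (q : Y -> Z) (f : fsfunc S X) :
  Smap q (Smap p f) = Smap (q \o p) f.
Proof. by apply: fsfuncP => z; rewrite !SmapE fsint_Smap. Qed.

Lemma eq_Smap (X Y : Type) (p q : X -> Y) (f : fsfunc S X) :
  (forall x, supp f x -> p x = q x) -> Smap p f = Smap q f.
Proof.
by move=> pq; apply: fsfuncP => y; rewrite !SmapE; apply: eq_fsint => x /pq->.
Qed.

Lemma Smap_id (X : Type) (f : fsfunc S X) : Smap id f = f.
Proof.
elim/fsfunc_ind: f => [|f s x IH]; first by rewrite Smap0.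
by rewrite SmapD IH Smap_single.
Qed.

Lemma Smap_cst (X Y : Type) (y : Y) (f : fsfunc S X) :
  Smap (fun=> y) f = fssingle (fsint f (fun=> 1)) y.
Proof.
apply: fsfuncP => z; rewrite SmapE !fssingleE; case: asboolP => _ //.
by rewrite fsint0r.
Qed.

(** Widening the sum from the support of [F] to all functions adds only zero terms, and makes the
    multiplication visibly additive in [F]. *)
Lemma SmultE (X : Type) (F : fsfunc S (fsfunc S X)) x :
  Smult F x = fsint F (fun f => f x).
Proof.
apply: fsbig_widen => // f [_ /= /contrapT F0].
by rewrite F0 mul0r.
Qed.

Lemma SmultD (X : Type) : {morph @Smult S X : F G / F + G}.
Proof. by move=> F G; apply: fsfuncP => y; rewrite fsfunD !SmultE fsintDl. Qed.

Lemma Smult0 (X : Type) : @Smult S X 0 = 0.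
Proof. by apply: fsfuncP => y; rewrite SmultE fsint0l. Qed.

Lemma Smult_single (X : Type) s (f : fsfunc S X) x :
  Smult (fssingle s f) x = s * f x.
Proof. by rewrite SmultE fsint_single. Qed.

Lemma Smult_SmapE (X Y : Type) (p : X -> fsfunc S Y) (f : fsfunc S X) y :
  Smult (Smap p f) y = fsint f (fun x => p x y).
Proof. by rewrite SmultE fsint_Smap. Qed.

Lemma Smult_natural (X Y : Type) (p : X -> Y) (F : fsfunc S (fsfunc S X)) :
  Smult (Smap (Smap p) F) = Smap p (Smult F).
Proof.
elim/fsfunc_ind: F => [|F s f IH]; first by rewrite !(Smap0, Smult0).
rewrite !(SmapD, SmultD) IH Smap_single; congr (_ + _).
apply: fsfuncP => y; rewrite Smult_single.
(* [Smult (fssingle s f)] is the scalar multiple of [f] by [s], hence additive in [f], so a second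
   induction on the inner function applies. *)
elim/fsfunc_ind: f => [|f t x IHf].
  rewrite Smap0 fsfun0 mulr0 (_ : Smult _ = 0) ?Smap0//.
  by apply: fsfuncP => x; rewrite Smult_single mulr0.
rewrite (_ : Smult _ = Smult (fssingle s f) + fssingle (s * t) x); last first.
  apply: fsfuncP => z; rewrite fsfunD !Smult_single fsfunD mulrDr.
  by congr (_ + _); rewrite !fssingleE; case: ifP; rewrite ?mulr0.
rewrite !SmapD !fsfunD -IHf mulrDr !Smap_single; congr (_ + _).
by rewrite !fssingleE; case: ifP; rewrite ?mulr0.
Qed.

End Integral.

(** * Supports, splittings and weak pullbacks over a positive refinable semiring *)

Section Positive.
Variables (S : pzSemiRingType).
Hypothesis Spos : positive_semiring S.

Lemma fsint_eq0 (X : Type) (f : fsfunc S X) u :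
  fsint f u = 0 -> forall x, f x * u x = 0.
Proof.
move=> f0 x; have [g [Ef _ _]] := fsfunc_split f x.
by move: f0; rewrite {1}Ef fsintDl fsint_single => /Spos[].
Qed.

Lemma suppDl (X : Type) (f g : fsfunc S X) : supp f `<=` supp (f + g).
Proof. by move=> x fx /Spos[]. Qed.

Lemma suppDr (X : Type) (f g : fsfunc S X) : supp g `<=` supp (f + g).
Proof. by rewrite addrC; exact: suppDl. Qed.

Lemma fsaddr_eq0 (X : Type) (f g : fsfunc S X) : f + g = 0 -> f = 0 /\ g = 0.
Proof.
move=> fg0; have fg x : f x = 0 /\ g x = 0 by apply: Spos; rewrite -fsfunD fg0.
by split; apply: fsfuncP => x; case: (fg x).
Qed.

Lemma supp_Smap (X Y : Type) (p : X -> Y) (f : fsfunc S X) x :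
  supp f x -> supp (Smap p f) (p x).
Proof.
move=> fx pfx0; apply: fx.
have : fsint f (fun t => fssingle 1 (p t) (p x)) = 0 by rewrite -SmapE.
by move=> /fsint_eq0/(_ x); rewrite fssingleE asboolT// mulr1.
Qed.

Lemma Smap_eq0 (X Y : Type) (p : X -> Y) (f : fsfunc S X) :
  Smap p f = 0 -> f = 0.
Proof.
move=> pf0; apply: fsfuncP => x; apply: contrapT => /(supp_Smap (p := p)).
by rewrite pf0.
Qed.

(** Lifts one point mass at a time. By positivity the support of a summand lies in that of the sum,
    so the range condition passes to the summands. *)
Lemma Smap_lift (X Y : Type) (p : X -> Y) (g : fsfunc S Y) :
  supp g `<=` range p -> exists f : fsfunc S X, Smap p f = g.
Proof.
elim/fsfunc_ind: g => [_|g s y IH sp]; first by exists 0; rewrite Smap0.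
have [f fg] : exists f, Smap p f = g by apply: IH => x gx; apply/sp/suppDl.
(* A point of weight zero is outside the support and may have no preimage. *)
have [s0|s0] := pselect (s = 0).
  by exists f; rewrite fg s0 fssingle0 addr0.
have [x _ xy] : range p y by apply/sp/suppDr; rewrite /supp /= asboolT.
by exists (f + fssingle s x); rewrite SmapD Smap_single fg xy.
Qed.

Lemma fssingle_eqD (X : Type) s (x : X) (f g : fsfunc S X) :
  fssingle s x = f + g -> f = fssingle (f x) x.
Proof.
move=> sfg; apply: fsfuncP => y; rewrite fssingleE; case: asboolP => [->//|yx].
have : (f + g) y = 0 by rewrite -sfg fssingleE asboolF.
by move=> /Spos[].
Qed.

Hypothesis Sref : refinable_semiring S.

Lemma fsfunc_dom (X : Type) (h : X -> S) (f : fsfunc S X) :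
  (forall x, f x = 0 -> h x = 0) -> exists g : fsfunc S X, forall x, g x = h x.
Proof.
move=> fh; have hfin : finite_set (supp h).
  by apply: (sub_finite_set _ (fsfunc_fin f)) => x hx /fh.
by exists (FSFunc hfin).
Qed.

(** The refinement is chosen pointwise. Positivity makes its entries vanish wherever [a],
    respectively [b], does, which gives finite supports. *)
Lemma fsfunc_refinable (X : Type) (a b c d : fsfunc S X) : a + b = c + d ->
  exists x y z t : fsfunc S X, [/\ x + y = a, z + t = b, x + z = c & y + t = d].
Proof.
move=> abcd.
have /choice[h hP] : forall i : X, exists q : (S * S) * (S * S),
    [/\ q.1.1 + q.1.2 = a i, q.2.1 + q.2.2 = b i,
        q.1.1 + q.2.1 = c i & q.1.2 + q.2.2 = d i].
  move=> i; have := congr1 (fun f : fsfunc S X => f i) abcd.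
  by rewrite !fsfunD => /Sref[x [y [z [t ?]]]]; exists ((x, y), (z, t)).
have [x xE] : exists g : fsfunc S X, forall i, g i = (h i).1.1.
  by apply: (@fsfunc_dom _ _ a) => i ai; have [+ _ _ _] := hP i;
    rewrite ai => /Spos[].
have [y yE] : exists g : fsfunc S X, forall i, g i = (h i).1.2.
  by apply: (@fsfunc_dom _ _ a) => i ai; have [+ _ _ _] := hP i;
    rewrite ai => /Spos[].
have [z zE] : exists g : fsfunc S X, forall i, g i = (h i).2.1.
  by apply: (@fsfunc_dom _ _ b) => i bi; have [_ + _ _] := hP i;
    rewrite bi => /Spos[].
have [t tE] : exists g : fsfunc S X, forall i, g i = (h i).2.2.
  by apply: (@fsfunc_dom _ _ b) => i bi; have [_ + _ _] := hP i;
    rewrite bi => /Spos[].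
exists x, y, z, t; split; apply: fsfuncP => i; rewrite fsfunD;
  by rewrite ?xE ?yE ?zE ?tE; have [] := hP i.
Qed.

(** Refining the image of [f] plus a point mass against [a + b] gives one splitting of the image,
    which lifts by induction, and one of the point mass. The latter has point masses as parts, and
    these lift to [x]. *)
Lemma Smap_eqD (X Y : Type) (p : X -> Y) (f : fsfunc S X) (a b : fsfunc S Y) :
  Smap p f = a + b ->
  exists g h : fsfunc S X, [/\ f = g + h, Smap p g = a & Smap p h = b].
Proof.
elim/fsfunc_ind: f a b => [|f s x IH] a b.
  rewrite Smap0 => /esym/fsaddr_eq0[-> ->].
  by exists 0, 0; split; rewrite ?addr0 ?Smap0.
rewrite SmapD Smap_single.
move=> /fsfunc_refinable[a1 [b1 [a2 [b2 [ab1 ab2 <- <-]]]]].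
have /IH[g [h [-> <- <-]]] := esym ab1.
have Ea2 := fssingle_eqD (esym ab2).
have Eb2 : b2 = fssingle (b2 (p x)) (p x).
  by apply: (@fssingle_eqD _ s _ _ a2); rewrite addrC.
have -> : s = a2 (p x) + b2 (p x) by rewrite -fsfunD ab2 fssingleE asboolT.
exists (g + fssingle (a2 (p x)) x), (h + fssingle (b2 (p x)) x).
by rewrite fssingleD addrACA !SmapD !Smap_single -Ea2 -Eb2.
Qed.

(** Builds a coupling by induction on [f]: each point mass of [f] claims a part of [g] lying over
    the same point of [Z]. *)
Lemma Smap_wpullback (X Y Z : Type) (p : X -> Z) (q : Y -> Z)
    (f : fsfunc S X) (g : fsfunc S Y) : Smap p f = Smap q g ->
  exists w : fsfunc S (X * Y), [/\ Smap fst w = f, Smap snd w = g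
    & forall t, supp w t -> p t.1 = q t.2].
Proof.
elim/fsfunc_ind: f g => [|f s x IH] g.
  rewrite Smap0 => /esym/Smap_eq0->.
  by exists 0; split; rewrite ?Smap0// => t; case.
rewrite SmapD Smap_single.
move=> /esym/Smap_eqD[g1 [g2 [-> /esym/IH[w [<- <- wP]] g2x]]].
(* All of [g2] lies over [p x] and has total mass [s], so it can be paired entirely with [x]. *)
exists (w + Smap (pair x) g2); split.
- rewrite SmapD Smap_comp Smap_cst; congr (_ + fssingle _ _).
  have := congr1 (fun h => fsint h (fun=> 1)) g2x.
  by rewrite fsint_Smap fsint_single mulr1.
- by rewrite SmapD Smap_comp Smap_id.
- move=> t wt; have [wt0|/wP//] := pselect (w t = 0).
  have /fsum_neq0[y /= <- /=] : supp (Smap (pair x) g2) t.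
    by move=> t0; apply: wt; rewrite fsfunD t0 wt0 addr0.
  move=> /(supp_Smap (p := q)); rewrite g2x /supp /= .
  by case: asboolP.
Qed.

End Positive.

(** * Naturality squares of the multiplication as weak pullbacks *)

Section MultWeaklyCartesian.
Variables (S : pzSemiRingType).
Hypothesis Spos : positive_semiring S.
Hypothesis Sref : refinable_semiring S.
Hypothesis SB : semiring_propB S.
Hypothesis SE : semiring_propE S.

(** Positivity makes every product [F f * f x] vanish, and (B) then leaves [f x = 0] on the support
    of [F]. *)
Lemma Smult_eq0 (X : Type) (F : fsfunc S (fsfunc S X)) :
  Smult F = 0 -> forall f, supp F f -> f = 0.
Proof.
move=> F0 f Ff; apply: fsfuncP => x.
have : fsint F (fun g => g x) = 0 by rewrite -SmultE F0.
by move=> /(fsint_eq0 Spos)/(_ f)/SB[].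
Qed.

(** At [x] the hypothesis reads [a x + s = c * f x], so (E) spreads the mass [c] over the
    decompositions of [f x]. In each pair of [t], the function keeps the first part of [f x] and the
    scalar records the part taken away. *)
Lemma Smult_single_eqD (X : Type) c (f a : fsfunc S X) s x :
  Smult (fssingle c f) = a + fssingle s x ->
  exists t : fsfunc S (fsfunc S X * S),
    [/\ Smap (fun q => q.1 + fssingle q.2 x) t = fssingle c f,
        Smult (Smap fst t) = a & fsint t snd = s].
Proof.
move=> cf; have E y : a y + fssingle s x y = c * f y.
  by rewrite -fsfunD -cf Smult_single.
have [t [ta ts tc]] : exists t : fsfunc S {p : S * S | p.1 + p.2 = f x},
    [/\ fsint t (fun p => (sval p).1) = a x,
        fsint t (fun p => (sval p).2) = s & fsint t (fun=> 1) = c].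
  have [|t [ta ts tc]] := SE (a := a x) (b := s) (c := c) (d := f x).
    by rewrite -E fssingleE asboolT.
  exists t; split=> //; rewrite -tc; apply: eq_fsbigr => p _.
  by rewrite mulr1.
have [g [Ef gx _]] := fsfunc_split f x.
pose h (p : {p : S * S | p.1 + p.2 = f x}) :=
  (g + fssingle (sval p).1 x, (sval p).2).
exists (Smap h t); split.
- rewrite Smap_comp -tc -Smap_cst; apply: eq_Smap => -[p /= pf] _.
  by rewrite -addrA -fssingleD pf -Ef.
- rewrite Smap_comp; apply: fsfuncP => y; rewrite Smult_SmapE /=.
  have [->|yx] := pselect (y = x).
    rewrite -ta; apply: eq_fsint => p _.
    by rewrite gx add0r asboolT.
  have fy : f y = g y by rewrite Ef fsfunD fssingleE asboolF// addr0.
  transitivity (c * f y); last by rewrite -E fssingleE asboolF// addr0.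
  (* Away from [x] every decomposition leaves the value [f y] intact, so only the total mass [c]
     matters. *)
  rewrite -tc -fsint_cst; apply: eq_fsint => p _.
  by rewrite asboolF// addr0 fy.
- by rewrite fsint_Smap.
Qed.

(** Extends the one-point case to all [F] by induction: refinement distributes [a] and the point
    mass at [x] between the rest of [F] and its last point. *)
Lemma Smult_eqD_single (X : Type) (F : fsfunc S (fsfunc S X)) a s x :
  Smult F = a + fssingle s x ->
  exists t : fsfunc S (fsfunc S X * S),
    [/\ Smap (fun q => q.1 + fssingle q.2 x) t = F,
        Smult (Smap fst t) = a & fsint t snd = s].
Proof.
elim/fsfunc_ind: F a s => [|F c f IH] a s.
  rewrite Smult0 => /esym/(fsaddr_eq0 Spos)[->].
  move=> /(congr1 (fun h : fsfunc S X => h x)).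
  rewrite fssingleE asboolT// => ->.
  by exists 0; rewrite !Smap0 Smult0 fsint0l.
rewrite SmultD => /(fsfunc_refinable Spos Sref).
move=> [a1 [s1 [a2 [s2 [F1 f2 <- s12]]]]].
have Es1 := fssingle_eqD Spos (esym s12).
have Es2 : s2 = fssingle (s2 x) x.
  by apply: (@fssingle_eqD _ Spos _ s _ _ s1); rewrite addrC.
have -> : s = s1 x + s2 x by rewrite -fsfunD s12 fssingleE asboolT.
have /IH[t1 [<- <- <-]] : Smult F = a1 + fssingle (s1 x) x by rewrite -Es1.
rewrite Es2 in f2; have [t2 [<- <- <-]] := Smult_single_eqD (esym f2).
by exists (t1 + t2); rewrite !SmapD SmultD fsintDl.
Qed.

(* Peeling one point off [f], property (E) splits [F] into the part carried by
   the rest of [f] and the share of that point; the two are glued along their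
   common marginal. *)
Lemma Smult_wpullback (X Y : Type) (p : X -> Y) (F : fsfunc S (fsfunc S Y))
    (f : fsfunc S X) : Smult F = Smap p f ->
  exists G : fsfunc S (fsfunc S X), Smult G = f /\ Smap (Smap p) G = F.
Proof.
elim/fsfunc_ind: f F => [|f s x IH] F.
  (* [F] is carried by the zero function, so its mass can be moved to the zero function over [X]. *)
  rewrite Smap0 => /Smult_eq0 F0; exists (Smap (fun=> 0) F); split.
    by apply: fsfuncP => x; rewrite Smult_SmapE fsint0r.
  rewrite Smap_comp -[RHS]Smap_id; apply: eq_Smap => g /F0 -> /=.
  by rewrite Smap0.
rewrite SmapD Smap_single => Ff.
have [t [<- /IH[G [Gf GF]] <-]] := Smult_eqD_single Ff.
have [w [wG wt wP]] := Smap_wpullback Spos Sref GF.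
exists (Smap (fun q => q.1 + fssingle q.2.2 x) w); split.
  apply: fsfuncP => y; rewrite Smult_SmapE fsintDr fsfunD -Gf -wG Smult_SmapE.
  congr (_ + _); rewrite -wt fsint_Smap !fssingleE; case: asboolP => yx.
    by apply: eq_fsint => q _; rewrite fssingleE asboolT.
  rewrite -[RHS](fsint0r w); apply: eq_fsint => q _.
  by rewrite fssingleE asboolF.
rewrite -wt !Smap_comp; apply: eq_Smap => q /wP /= <-.
by rewrite SmapD Smap_single.
Qed.

End MultWeaklyCartesian.

(** * The extension to relations: uniqueness, functoriality, multiplication *)

Section Extension.
Variables (S : pzSemiRingType).

(* The Barr extension of the functor. *)
Definition Srel (X Y : Type) (R : set (X * Y)) :
    set (fsfunc S X * fsfunc S Y) :=
  [set fg | exists w : fsfunc S {p : X * Y | R p},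
     Smap (fst \o sval) w = fg.1 /\ Smap (snd \o sval) w = fg.2].

(* A monotone functor on relations preserves the adjunction between the graph
   of a function and its converse. *)
Lemma monotone_extension_converse E : is_monotone_extension E ->
  forall (X Y : Type) (p : X -> Y),
    E Y X [set q | p q.2 = q.1] = [set q | @Smap S X Y p q.2 = q.1].
Proof.
move=> [Eid Ecomp Emon Egraph] X Y p; apply/seteqP; split=> -[g f] /=.
  move=> gf.
  have : E Y Y (rel_comp [set q : Y * X | p q.2 = q.1] (rel_graph p))
      (g, Smap p f).
    by rewrite Ecomp Egraph; exists f.
  have /Emon/[apply] : rel_comp [set q : Y * X | p q.2 = q.1] (rel_graph p)
      `<=` diagonal.
    by move=> [y y'] [x xy xy']; exact: etrans (esym xy) xy'.
  by rewrite Eid.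
move=> pfg.
have : E X X (rel_comp (rel_graph p) [set q : Y * X | p q.2 = q.1]) (f, f).
  have /Emon : diagonal `<=`
      rel_comp (rel_graph p) [set q : Y * X | p q.2 = q.1].
    by move=> [x x'] xx'; exists (p x') => //; exact: congr1 (xx' : x = x').
  by apply; rewrite Eid.
by rewrite Ecomp Egraph => -[h /=]; rewrite /rel_graph /= pfg => <-.
Qed.

Lemma monotone_extension_unique E : @is_monotone_extension S E ->
  forall (X Y : Type) (R : set (X * Y)), E X Y R = Srel R.
Proof.
move=> HE X Y R; have [Eid Ecomp Emon Egraph] := HE.
pose p := fst \o @sval _ R; pose q := snd \o @sval _ R.
(* [R] is tabulated by the two projections from the type of its own elements. *)
have RE : R = rel_comp [set t | p t.2 = t.1] (rel_graph q).
  apply/seteqP; split=> [[x y] Rxy|[x y] [[[x' y'] r]]]; last first.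
    by rewrite /rel_graph /= => <- <-.
  by exists (exist _ (x, y) Rxy).
rewrite [in LHS]RE Ecomp Egraph monotone_extension_converse//.
by apply/seteqP; split=> [[f g] [w wf wg]|[f g] [w [wf wg]]]; exists w.
Qed.

Lemma Srel_mono (X Y : Type) (R Q : set (X * Y)) :
  R `<=` Q -> Srel R `<=` Srel Q.
Proof.
move=> RQ [f g] [w [/= <- <-]].
exists (Smap (fun p : {p | R p} => exist _ (sval p) (RQ _ (svalP p))) w).
by rewrite !Smap_comp.
Qed.

Hypothesis Spos : positive_semiring S.

(** Allows a coupling to live on any type [W], with [R] required only on its support; [Smap_lift]
    moves it to the subtype. *)
Lemma Srel_Smap (W X Y : Type) (R : set (X * Y)) (p : W -> X) (q : W -> Y)
    (w : fsfunc S W) : (forall t, supp w t -> R (p t, q t)) ->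
  Srel R (Smap p w, Smap q w).
Proof.
move=> wR; have [|v <-] := @Smap_lift _ Spos {t | R (p t, q t)} W sval w.
  by move=> t /wR Rt; exists (exist _ t Rt).
pose h (t : {t | R (p t, q t)}) : {r | R r} :=
  exist R (p (sval t), q (sval t)) (svalP t).
by exists (Smap h v); rewrite !Smap_comp.
Qed.

Lemma Srel_graph (X Y : Type) (p : X -> Y) :
  Srel (rel_graph p) = rel_graph (Smap p).
Proof.
apply/seteqP; split=> -[f g].
  move=> [w [/= <- <-]]; rewrite /rel_graph /= Smap_comp.
  by apply: eq_Smap => -[].
rewrite {1}/rel_graph /= => <-.
by rewrite -{1}[f]Smap_id; exact: Srel_Smap.
Qed.

Lemma Srel_diagonal (X : Type) : Srel (@diagonal X) = diagonal.
Proof.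
rewrite (_ : diagonal = rel_graph id)//; rewrite Srel_graph.
by apply/seteqP; split=> -[f g]; rewrite /rel_graph /diagonal /= Smap_id.
Qed.

Hypothesis Sref : refinable_semiring S.

Lemma Srel_comp (X Y Z : Type) (R : set (X * Y)) (Q : set (Y * Z)) :
  Srel (rel_comp R Q) = rel_comp (Srel R) (Srel Q).
Proof.
apply/seteqP; split=> -[f h].
  move=> [w [/= <- <-]].
  (* Triples with an explicit middle point map onto the composite relation, so the coupling lifts to
     them and projects to both factors. *)
  pose T := {t : X * Y * Z | R (t.1.1, t.1.2) /\ Q (t.1.2, t.2)}.
  pose pr (t : T) : {p | rel_comp R Q p} := exist (rel_comp R Q)
    ((sval t).1.1, (sval t).2)
    (ex_intro2 _ _ (sval t).1.2 (svalP t).1 (svalP t).2).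
  have [|v <-] := @Smap_lift _ Spos _ _ pr w.
    move=> [[x z] [y Rxy Qyz]] _.
    by exists (exist _ ((x, y), z) (conj Rxy Qyz) : T) => //; exact: eq_exist.
  rewrite !Smap_comp; exists (Smap (fun t : T => (sval t).1.2) v);
    by apply: Srel_Smap => t _; case: (svalP t).
move=> [g [u [/= <- ug]] [v [/= vg <-]]].
(* Conversely, the two couplings are glued along their common marginal [g]. *)
have [w [<- <- wP]] := Smap_wpullback Spos Sref (etrans ug (esym vg)).
rewrite !Smap_comp; apply: Srel_Smap => -[[[x y] Rxy] [[y' z] Qyz]] /wP /=.
by move=> yy'; subst y'; exists y.
Qed.

Lemma Srel_monotone_extension : is_monotone_extension Srel.
Proof.
split; [exact: Srel_diagonal | exact: Srel_comp | exact: Srel_mono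
       | exact: Srel_graph].
Qed.

Hypothesis SB : semiring_propB S.
Hypothesis SE : semiring_propE S.

Lemma Srel_Smult : Smult_extends Srel.
Proof.
move=> X Y R; apply/seteqP; split=> -[F g].
  move=> [G [W [/= <- <-]]]; rewrite {1}/rel_graph /= => <-.
  (* Each related pair consists of the marginals of some coupling, so [W] lifts to a function [V] on
     couplings, and [Smult V] is the coupling sought. *)
  have [|V VW] := @Smap_lift _ Spos _ _ (fun w : fsfunc S {p | R p} =>
      (Smap (fst \o sval) w, Smap (snd \o sval) w)) (Smap sval W).
    move=> [f h] /fsum_neq0[[[f' h'] [w [wf wh]]] <- _].
    by exists w => //; exact: congr2 wf wh.
  exists (Smult (Smap (fst \o sval) W)) => //=.
  rewrite -!Smap_comp -VW !Smap_comp.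
  by exists (Smult V); rewrite -!Smult_natural.
rewrite {1}/rel_graph /= => -[f /= <- [w [/= wF <-]]].
(* Conversely, [w] has first marginal [Smult F], so it is itself the multiplication of some [W] on
   couplings whose first marginals give [F]. *)
have [W [<- WF]] := Smult_wpullback Spos Sref SB SE (esym wF).
exists (Smap (Smap (snd \o sval)) W); last exact: Smult_natural.
rewrite -WF; apply: Srel_Smap => h _; exists h; split=> //.
Qed.

End Extension.

(** * The law as transpose of the extended membership relation, and its axioms *)

(** The two sums defining [delta] run over the fibres of the projections of [ni], so [ni_pair]
    reindexes them as the marginals of [psi]. *)
Lemma delta_Srel (S : pzSemiRingType) (X : Type) (Phi : fsfunc S (set X)) :
  delta Phi = [set phi | Srel (@ni X) (Phi, phi)].
Proof.
have rowE (w : fsfunc S {p | @ni X p}) (A : set X) :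
    Smap (fst \o sval) w A =
    fsum setT (fun x : {x | A x} => w (ni_pair (svalP x))).
  apply: (reindex_fsbig (I := {classic {x | A x}})
    (fun x => ni_pair (svalP x) : {classic _})); split=> //.
  - by move=> [x Ax] [y Ay] _ _ [xy]; exact: eq_exist.
  - move=> [[B x] Bx] /= BA; subst B.
    by exists (exist _ x Bx) => //; exact: eq_exist.
have colE (w : fsfunc S {p | @ni X p}) (x : X) :
    Smap (snd \o sval) w x =
    fsum setT (fun A : {A : set X | A x} =>
      w (@ni_pair X (sval A) x (svalP A))).
  apply: (reindex_fsbig (I := {classic {A : set X | A x}})
    (fun A => @ni_pair X (sval A) x (svalP A) : {classic _})); split=> //.
  - by move=> [A Ax] [B Bx] _ _ [AB]; exact: eq_exist.
  - move=> [[B y] Bx] /= yx; subst y.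
    by exists (exist (fun A : set X => A x) B Bx) => //; exact: eq_exist.
apply/seteqP; split=> phi [w].
  by move=> [wA wx]; exists w; split; apply: fsfuncP => ? /=;
    rewrite ?wA ?wx; [exact: rowE | exact: colE].
move=> [/= <- <-]; exists w; split; [exact: rowE | exact: colE].
Qed.

(* Each axiom of a weak distributive law is the image under the extension of an
   identity between relations built from graphs and [ni]. *)
Lemma canonical_weak_distributive_law (S : pzSemiRingType)
    (d : forall X : Type, fsfunc S (set X) -> set (fsfunc S X)) :
  is_canonical_law d -> is_weak_distributive_law d.
Proof.
move=> [E [[Eid Ecomp Emon Egraph] _ Emult dE]].
(* Translates precomposition with [Smap k] into the extension of the relation transposed from [k].
   It serves all four axioms, with [k] being [Pmap f], [Pmult], [d X] and [Punit]. *)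
have E_graph_ni (Y X : Type) (k : Y -> set X) F g :
    E _ _ (@ni X) (Smap k F, g) <-> E _ _ [set p | k p.1 p.2] (F, g).
  have -> : [set p | k p.1 p.2] = rel_comp (rel_graph k) (@ni X).
    apply/seteqP; split=> [[y x] kyx|[y x] [A]]; first by exists (k y).
    by rewrite /rel_graph /= => <-.
  rewrite Ecomp Egraph; split=> [|[G]]; first by exists (Smap k F).
  by rewrite /rel_graph /= => <-.
split.
- move=> X Y f; apply/funext => F /=; rewrite !dE; apply/seteqP; split=> g.
    move=> /E_graph_ni.
    rewrite (_ : [set _ | _] = rel_comp (@ni X) (rel_graph f)); last first.
      by apply/seteqP; split=> -[A y] [x]; exists x.
    by rewrite Ecomp Egraph => -[h]; exists h.
  move=> [h Fh hg]; apply/E_graph_ni.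
  rewrite (_ : [set _ | _] = rel_comp (@ni X) (rel_graph f)); last first.
    by apply/seteqP; split=> -[A y] [x]; exists x.
  by rewrite Ecomp Egraph; exists h.
- move=> X; apply/funext => F /=; rewrite !dE.
  have E2 : [set p : set (set X) * X | Pmult p.1 p.2] =
      rel_comp (@ni (set X)) (@ni X).
    by apply/seteqP; split=> -[A x] [B]; exists B.
  apply/seteqP; split=> g.
    move=> /E_graph_ni; rewrite E2 Ecomp => -[G FG Gg].
    by exists (d X G); [exists G | rewrite dE].
  move=> [_ [G FG <-]]; rewrite dE => Gg.
  by apply/E_graph_ni; rewrite E2 Ecomp; exists G.
- move=> X; apply/funext => F /=; rewrite !dE.
  (* The relation transposed from [d X] is the extension of [ni], so [Smap (d X)] leads to the twice
     extended [ni], to which [Emult] applies. *)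
  have dni : [set p : fsfunc S (set X) * fsfunc S X | d X p.1 p.2] =
      E _ _ (@ni X) by apply/seteqP; split=> -[f g] /=; rewrite dE.
  have EE g : E _ _ (@ni X) (Smult F, g) <->
      rel_comp (E _ _ (E _ _ (@ni X))) (rel_graph (@Smult S X)) (F, g).
    rewrite Emult; split=> [Fg|[G]]; first by exists (Smult F).
    by rewrite {1}/rel_graph /= => <-.
  apply/seteqP; split=> g.
    move=> /EE[G FG Gg]; exists G => //.
    by apply/E_graph_ni; rewrite dni.
  move=> [G /E_graph_ni FG Gg]; apply/EE; exists G => //.
  by rewrite -dni.
- move=> X; apply/funext => F /=; rewrite dE.
  have D : [set p : X * X | Punit p.1 p.2] = diagonal.
    by apply/seteqP; split=> -[x y] /esym.
  apply/seteqP; split=> g; first by move=> /E_graph_ni; rewrite D Eid => /esym.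
  by move=> ->; apply/E_graph_ni; rewrite D Eid.
Qed.

Theorem theorem3p1 (S : pzSemiRingType)
    (Spos : positive_semiring S) (Sref : refinable_semiring S)
    (SB : semiring_propB S) (SE : semiring_propE S) :
  is_weak_distributive_law (@delta S) /\ is_canonical_law (@delta S).
Proof.
(* Canonicity comes first, because the axioms of the law follow from it. *)
have canon : is_canonical_law (@delta S).
  exists (@Srel S); split.
  - exact: Srel_monotone_extension.
  - by move=> E' /monotone_extension_unique.
  - exact: Srel_Smult.
  - exact: delta_Srel.
by split=> //; exact: canonical_weak_distributive_law.
Qed.
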